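(* Let $n\ge1$ and $k\ge1$ be integers. The number of $n$-cycles with descent set $k\mathbb{Z}\cap[n-1]$ is given by \[ \beta^{\mathrm{cyc}}_n(k\mathbb{Z}\cap[n-1])=\frac1n\sum_{d\mid n}\mathrm{M\ddot{o}b}(d)\,(-1)^{\left\lfloor\frac{n-1}{k}\right\rfloor-\left\lfloor\frac{n-d}{\mathrm{lcm}(k,d)}\right\rfloor}\,E_{n/d}^{\left(k/\gcd(k,d)\right)}. \]
   Context: $[n]=\{1,\dots,n\}$. $S_n$ is the symmetric group on $[n]$ and $C_n\subseteq S_n$ is the set of permutations consisting of a single cycle of length $n$. The descent set of $\pi\in S_n$ is $D(\pi)=\{i\in[n-1]:\pi(i)>\pi(i+1)\}$. For $I\subseteq[n-1]$, $\beta_n(I)=\#\{\pi\in S_n: D(\pi)=I\}$ and $\beta^{\mathrm{cyc}}_n(I)=\#\{\pi\in C_n: D(\pi)=I\}$. The generalized Euler numbers are $E_n^{(k)}=\beta_n(k\mathbb{Z}\cap[n-1])$, the number of permutations in $S_n$ with descent set $k\mathbb{Z}\cap[n-1]$. $\mathrm{M\ddot{o}b}$ is the number-theoretic Möbius function; sums over $d$ range over positive divisors. *)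

(* Defs.v *)
From mathcomp Require Import all_boot all_order all_algebra all_fingroup.

Set Implicit Arguments.
Unset Strict Implicit.
Unset Printing Implicit Defensive.

Import GRing.Theory Num.Theory.

(* Permutations in 'S_n act on {0, .., n-1}, so the 1-based position i is the
   ordinal of value i-1.  Descents nevertheless keep their 1-based numbering:
   i in [n-1] is a descent of s when s takes a larger value at the ordinal of
   value i-1 than at the ordinal of value i.  Subsets of [n-1] are thus the
   subsets of 'I_n that do not contain 0. *)
Definition descent_set (n : nat) (s : 'S_n) : {set 'I_n} :=
  [set i : 'I_n | [exists j : 'I_n, (j.+1 == i) && (s i < s j)]].

Definition n_cycles (n : nat) : {set 'S_n} :=
  [set s : 'S_n | porbits s == [set [set: 'I_n]]].

Definition beta (n : nat) (I : {set 'I_n}) : nat :=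
  #|[set s : 'S_n | descent_set s == I]|.

Definition beta_cyc (n : nat) (I : {set 'I_n}) : nat :=
  #|[set s in n_cycles n | descent_set s == I]|.

Definition multiples (k n : nat) : {set 'I_n} :=
  [set i : 'I_n | (0 < i) && (k %| i)].

Definition gen_euler (k n : nat) : nat := beta (multiples k n).

Definition moebius (n : nat) : int :=
  if (0 < n) && all (fun p => logn p n == 1) (primes n)
  then ((-1) ^+ size (primes n))%R else 0%R.

(* Main.v *)
Require Import Defs.
From mathcomp Require Import all_boot all_order all_algebra all_fingroup.
From mathcomp Require Import zify.

(** Fix a set J of allowed descents. It cuts the positions into consecutive
    blocks, and D(s) is a subset of J exactly when s is increasing on every
    block. Label each position by its block; the words with the same content as
    this labelling count such permutations in two ways.

    - Every word with that content is obtained from exactly one permutation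
      increasing on the blocks, by standardization: the letters of the word are
      sorted, ties being broken by position ([card_block_increasing]).
    - A primitive word with that content is obtained from exactly one pair
      (s, x), where s is an n-cycle increasing on the blocks and x a starting
      point, as the sequence of blocks visited by x, s x, s (s x), and so on.
      Conversely s is read off from the lexicographic order of the rotations of
      the word ([card_cycles_block_increasing]). This is the case of a single
      cycle in the correspondence of Gessel and Reutenauer between permutations
      and multisets of primitive necklaces.

    Primitive words are isolated by Moebius inversion along the cyclic group: for
    a word of length n, the sum of Moeb(d) over the d | n such that the rotation
    by n / d fixes the word is 1 if the word is primitive and 0 otherwise
    ([primitive_sum_moebius]). A word fixed by the rotation by n / d is a d-th
    power; with the content of J this happens only if d divides every element
    of J, and the base of the power is then any word with the content of J / d
    ([count_rot_fixed_words]).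

    Hence n times the number of n-cycles with D(s) in J is the sum over d | n,
    restricted to the d dividing all of J, of Moeb(d) times the number of
    permutations of size n / d with descents in J / d. Inclusion-exclusion over
    the subsets J of I turns this into a formula for the n-cycles with descent
    set exactly I, valid for every I ([beta_cyc_moebius]): the subsets J of I
    made of multiples of d are the subsets of the part of I divisible by d, and
    the sign picks up a factor (-1) for each element of I not divisible by d.
    For I = kZ, the part divisible by d is lcm(k, d)Z, and dividing it by d
    gives (k / gcd(k, d))Z. *)

Set Implicit Arguments.
Unset Strict Implicit.
Unset Printing Implicit Defensive.

Import Order.TTheory GRing.Theory Num.Theory.

(** * Ranking permutations *)

Lemma count_lt_iota m n : m <= n -> count (fun i => i < m) (iota 0 n) = m.
Proof.
move=> le_mn; rewrite -(subnKC le_mn) iotaD count_cat (eq_in_count (a2 := predT)).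
  rewrite count_predT size_iota (eq_in_count (a2 := pred0)) ?count_pred0 ?addn0 //.
  by move=> k; rewrite mem_iota add0n => /andP[/leq_gtF-> _].
by move=> k; rewrite mem_iota => /andP[_ ->].
Qed.

Lemma card_lt_perm n (r : 'S_n) (i : 'I_n) : #|[set j | r j < r i]| = r i.
Proof.
rewrite -(card_imset _ (@perm_inj _ r)).
have -> : r @: [set j | r j < r i] = [set k : 'I_n | k < r i].
  apply/setP=> k; rewrite inE; apply/imsetP/idP=> [[j]|ltk].
    by rewrite inE => ltj ->.
  by exists ((r^-1)%g k); rewrite ?inE permKV.
rewrite cardsE cardE size_filter -enumT.
rewrite -(count_map val (fun k => k < r i)) val_enum_ord.
by rewrite count_lt_iota // ltnW.
Qed.

(** The rank of i is the number of indices with a smaller key. Both word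
    correspondences below build their permutation in this way, from the keys
    (letter, position) and from the rotations of a word respectively. *)
Lemma rank_perm_exists disp (T : orderType disp) n (f : 'I_n -> T) :
  injective f -> exists r : 'S_n, forall i j, (r i < r j) = (f i < f j)%O.
Proof.
move=> f_inj; pose below i := [set j | (f j < f i)%O].
have below_lt i : #|below i| < n.
  rewrite -[X in _ < X]card_ord -cardsT proper_card // properT.
  by apply: contraTneq (in_setT i) => <-; rewrite inE ltxx.
have lt_below i j : (f i < f j)%O -> #|below i| < #|below j|.
  move=> ltij; apply/proper_card/properP; split.
    by apply/subsetP=> k; rewrite !inE => /lt_trans->.
  by exists i; rewrite inE // ltxx.
pose rk i := Ordinal (below_lt i).
have rkE i j : (rk i < rk j) = (f i < f j)%O.
  apply/idP/idP=> [|/lt_below//]; case: ltgtP => //= [/lt_below|/f_inj->].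
    by case: ltngtP.
  by rewrite ltnn.
have rk_inj : injective rk.
  move=> i j eq_rk; apply: f_inj; have := rkE i j; have := rkE j i.
  by rewrite eq_rk !ltnn; case: ltgtP.
by exists (perm rk_inj) => i j; rewrite !permE.
Qed.

(** A permutation compatible with the order of the keys has to be the ranking
    permutation: this gives the injectivity of both word correspondences. *)
Lemma rank_perm_unique disp (T : orderType disp) n (f : 'I_n -> T) (r r' : 'S_n) :
    (forall i j, r i < r j -> (f i < f j)%O) ->
    (forall i j, r' i < r' j -> (f i < f j)%O) ->
  r = r'.
Proof.
have key (s : 'S_n) : (forall i j, s i < s j -> (f i < f j)%O) ->
    forall i j, (s i < s j) = (f i < f j)%O.
  move=> sP i j; apply/idP/idP=> [/sP//|]; case: ltngtP => // [/sP|/val_inj/perm_inj->].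
    by case: ltgtP.
  by rewrite ltxx.
move=> /key rE /key r'E; apply/permP=> i; apply: val_inj; rewrite /=.
rewrite -(card_lt_perm r) -(card_lt_perm r').
by apply: eq_card => j; rewrite !inE rE r'E.
Qed.

Lemma perm_eq_image_perm (T : eqType) n (f : 'I_n -> T) (s : 'S_n) :
  perm_eq [seq f (s i) | i : 'I_n] [seq f i | i : 'I_n].
Proof.
rewrite /image_mem (map_comp f) perm_map //.
apply: uniq_perm; rewrite ?(map_inj_uniq (@perm_inj _ s)) ?enum_uniq //.
move=> i; rewrite mem_enum; apply/mapP; exists ((s^-1)%g i).
  by rewrite mem_enum.
by rewrite permKV.
Qed.

Lemma mkseq_image T n (f : nat -> T) : mkseq f n = [seq f i | i : 'I_n].
Proof. by rewrite /mkseq -val_enum_ord -map_comp /image_mem enumT. Qed.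

(** If the ranking sorts the letters of w, then reading w along the ranking
    gives a nondecreasing word with the content of c; as c is nondecreasing, the
    two sorted words coincide. *)
Lemma rank_perm_content n (c : nat -> nat) (w : seq nat) (r : 'S_n) :
    {homo c : i j / i <= j} -> perm_eq w (mkseq c n) ->
    (forall i j, r i < r j -> nth 0 w i <= nth 0 w j) ->
  forall i, c (r i) = nth 0 w i.
Proof.
move=> c_mono wP rP; have sz_w : size w = n by rewrite (perm_size wP) size_mkseq.
(* v is w sorted by the ranking r *)
pose v := [seq nth 0 w ((r^-1)%g i) | i : 'I_n].
have vE : v = mkseq c n.
  apply: (@sorted_eq _ leq leq_trans anti_leq).
  - apply: (homo_sorted (e := fun i j : 'I_n => i < j)).
      by move=> i j ltij; apply: rP; rewrite !permKV.
    have := iota_ltn_sorted 0 n; rewrite -val_enum_ord sorted_map.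
    by rewrite enumT.
  - by apply: (homo_sorted c_mono); apply: iota_sorted.
  - apply: perm_trans wP.
    rewrite -[X in perm_eq _ X](mkseq_nth 0 w) sz_w mkseq_image.
    exact: (perm_eq_image_perm (fun i : 'I_n => nth 0 w i)).
move=> i; have := congr1 (nth 0 ^~ (r i)) vE.
rewrite nth_mkseq // /v /image_mem (nth_map i) -?enumT ?size_enum_ord //.
by rewrite nth_ord_enum permK.
Qed.

(** * Standardization *)

Definition block_increasing (c : nat -> nat) n : {set 'S_n} :=
  [set s : 'S_n | [forall i : 'I_n, forall j : 'I_n,
     (i < j) && (c i == c j) ==> (s i < s j)]].

Lemma block_increasingP (c : nat -> nat) n (s : 'S_n) :
  reflect (forall i j : 'I_n, i < j -> c i = c j -> s i < s j)
          (s \in block_increasing c n).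
Proof.
rewrite inE; apply: (iffP forallP) => [sP i j ltij cij|sP i].
  by have /forallP/(_ j)/implyP := sP i; apply; rewrite ltij cij /=.
by apply/forallP=> j; apply/implyP=> /andP[ltij /eqP]; apply: sP.
Qed.

Lemma card_eq_size (T : finType) (T' : eqType) (A : {set T}) (f : T -> T') L :
    uniq L -> {in A &, injective f} -> {in A, forall x, f x \in L} ->
    (forall y, y \in L -> exists2 x, x \in A & f x = y) ->
  #|A| = size L.
Proof.
move=> L_uniq f_inj fL f_surj; rewrite cardE -(size_map f).
apply/perm_size/uniq_perm=> //.
  by rewrite map_inj_in_uniq ?enum_uniq // => x y; rewrite !mem_enum; apply: f_inj.
move=> y; apply/mapP/idP=> [[x]|/f_surj[x xA <-]]; first by rewrite mem_enum => /fL+ ->.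
by exists x; rewrite ?mem_enum.
Qed.

Definition words (c : nat -> nat) n := permutations (mkseq c n).

(** Standardization: s corresponds to the word whose letter at i is c (s^-1 i).
    As s is increasing on the level sets of c, its inverse ranks the positions
    of that word by letter first and by position next. *)
Lemma card_block_increasing c n : {homo c : i j / i <= j} ->
  #|block_increasing c n| = size (words c n).
Proof.
move=> c_mono; pose word (s : 'S_n) := [seq c ((s^-1)%g i) | i : 'I_n].
have nth_word s (i : 'I_n) : nth 0 (word s) i = c ((s^-1)%g i).
  by rewrite (nth_map i) -?enumT ?size_enum_ord // nth_ord_enum.
apply: (card_eq_size (f := word)) => [|s t sP tP eq_w|s _|w].
- exact: permutations_uniq.
- apply: invg_inj.
  pose key (i : 'I_n) : nat *l nat := (nth 0 (word s) i, i : nat).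
  have keyP u : u \in block_increasing c n -> word u = word s ->
      forall i j, (u^-1)%g i < (u^-1)%g j -> (key i < key j)%O.
    move=> /block_increasingP uP eq_u i j ltij; rewrite /key -eq_u !nth_word.
    rewrite Order.ProdLexiOrder.ltxi_pair.
    have le_ij := c_mono _ _ (ltnW ltij).
    apply/andP; split; first exact: le_ij.
    apply/implyP=> le_ji.
    move: (uP _ _ ltij); rewrite !permKV; apply.
    by apply/eqP; rewrite eqn_leq le_ij.
  by apply: (rank_perm_unique (f := key)); apply: keyP.
- rewrite mem_permutations mkseq_image.
  exact: (perm_eq_image_perm (fun i : 'I_n => c i)).
- rewrite mem_permutations => wP.
  have sz_w : size w = n by rewrite (perm_size wP) size_mkseq.
  pose key (i : 'I_n) : nat *l nat := (nth 0 w i, i : nat).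
  have [|r rE] := rank_perm_exists (f := key); first by move=> i j [_ /val_inj].
  have ltr i j : (r i < r j) =
     (nth 0 w i <= nth 0 w j) && ((nth 0 w j <= nth 0 w i) ==> (i < j)).
    by rewrite rE Order.ProdLexiOrder.ltxi_pair.
  have cr := rank_perm_content c_mono wP (r := r).
  have {}cr i : c (r i) = nth 0 w i.
    by apply: cr => {}i j; rewrite ltr => /andP[].
  exists (r^-1)%g.
    apply/block_increasingP=> i j ltij eq_c.
    move: ltij eq_c; rewrite -[i](permKV r) -[j](permKV r) !permK.
    rewrite ltr !cr => /andP[_ /implyP] lt_ij eq_c.
    by apply: lt_ij; rewrite eq_c.
  apply: (@eq_from_nth _ 0); first by rewrite size_map size_enum_ord.
  move=> i; rewrite size_map size_enum_ord => lt_in.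
  by rewrite (nth_word _ (Ordinal lt_in)) invgK cr.
Qed.

(** * Primitive words and cyclic permutations *)

Definition primitive (w : seq nat) :=
  all (fun m => rot m w != w) (iota 1 (size w).-1).

Lemma primitiveP w :
  reflect (forall m, 0 < m < size w -> rot m w != w) (primitive w).
Proof.
have iotaE m : (m \in iota 1 (size w).-1) = (0 < m < size w).
  by rewrite mem_iota; case: (size w) => [|k] //=; case: m.
by apply: (iffP allP) => wP m; have := wP m; rewrite iotaE.
Qed.

Lemma rot_eq_primitive w i j :
  primitive w -> i < size w -> j < size w -> rot i w = rot j w -> i = j.
Proof.
move=> /primitiveP w_prim.
wlog lt_ij: i j / i < j => [IH lti ltj eqr|lti ltj].
  by case: (ltngtP i j) => // [|] lt; [|apply/esym]; apply: IH.
rewrite -[in rot j w](subnKC (ltnW lt_ij)) rotD; last lia.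
move=> /rot_inj/esym/eqP; apply: contraTeq => _; apply: w_prim.
by rewrite subn_gt0 lt_ij (leq_ltn_trans (leq_subr _ _)).
Qed.

(** Together with the cancellation of a common first letter, this compares the
    successors of two rotations that start with the same letter. *)
Lemma ltxi_rcons (u v : seq nat) a b : size u = size v ->
  ((u : seqlexi nat) < v)%O -> ((rcons u a : seqlexi nat) < rcons v b)%O.
Proof.
elim: u v => [|x u IH] [|y v] //= [eq_sz]; rewrite !ltxi_cons.
case/andP=> le_xy /implyP ltuv; apply/andP; split=> //.
by apply/implyP=> /ltuv; apply: IH.
Qed.

Lemma porbit_n_cycle n (s : 'S_n.+1) :
  s \in n_cycles n.+1 -> forall x, porbit s x = setT.
Proof.
rewrite inE => /eqP s_orb x.
by apply/set1P; rewrite -s_orb imset_f.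
Qed.

Lemma iter_n_cycle n (s : 'S_n.+1) :
  s \in n_cycles n.+1 -> forall x, iter n.+1 s x = x.
Proof.
move=> s_cycle x; have := iter_porbit s x.
by rewrite porbit_n_cycle // cardsT card_ord.
Qed.

Lemma traject_n_cycle n (s : 'S_n.+1) : s \in n_cycles n.+1 ->
  forall x, uniq (traject s x n.+1) /\ traject s x n.+1 =i predT.
Proof.
move=> s_cycle x.
have eq_n : #|porbit s x| = n.+1 by rewrite porbit_n_cycle // cardsT card_ord.
split=> [|y]; first by have := uniq_traject_porbit s x; rewrite eq_n.
by have := porbit_traject s x y; rewrite eq_n porbit_n_cycle // inE => <-.
Qed.

Lemma iter_n_cycle_inj n (s : 'S_n.+1) : s \in n_cycles n.+1 ->
  forall x i j, i < n.+1 -> j < n.+1 -> iter i s x = iter j s x -> i = j.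
Proof.
move=> s_cycle x i j lti ltj.
have [/(nth_uniq x) u_tr _] := traject_n_cycle s_cycle x.
rewrite -!(@nth_traject _ s _ n.+1) // => /eqP.
by rewrite u_tr ?size_traject // => /eqP.
Qed.

Lemma iter_n_cycle_surj n (s : 'S_n.+1) : s \in n_cycles n.+1 ->
  forall x y, exists2 t, t < n.+1 & y = iter t s x.
Proof.
by move=> s_cycle x y; apply/trajectP; have [_ ->] := traject_n_cycle s_cycle x.
Qed.

Definition itinerary n (c : nat -> nat) (s : 'S_n) x m :=
  [seq c (y : 'I_n) | y <- traject s x m].

Lemma size_itinerary n c (s : 'S_n) x m : size (itinerary c s x m) = m.
Proof. by rewrite size_map size_traject. Qed.

(** Two points of the same block keep their order under s, so their itineraries
    can only separate in the direction of the initial inequality. *)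
Lemma le_itinerary n c (s : 'S_n) m (x y : 'I_n) :
    {homo c : i j / i <= j} -> s \in block_increasing c n -> x < y ->
  ((itinerary c s x m : seqlexi nat) <= itinerary c s y m)%O.
Proof.
move=> c_mono /block_increasingP s_incr.
elim: m x y => [|m IH] x y lt_xy //=; rewrite /itinerary /= lexi_cons.
have le_c := c_mono _ _ (ltnW lt_xy).
apply/andP; split; first exact: le_c.
apply/implyP=> ge_c; apply/IH/s_incr => //.
by apply/eqP; rewrite eqn_leq le_c.
Qed.

Lemma rot_itinerary n c (s : 'S_n.+1) x a : s \in n_cycles n.+1 -> a <= n.+1 ->
  rot a (itinerary c s x n.+1) = itinerary c s (iter a s x) n.+1.
Proof.
move=> s_cyc le_an; rewrite -map_rot; congr map.
have -> : traject s x n.+1 = traject s x a ++ traject s (iter a s x) (n.+1 - a).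
  by rewrite -trajectD subnKC.
rewrite -[X in rot X](size_traject s x a) rot_size_cat.
have -> : traject s x a = traject s (iter (n.+1 - a) s (iter a s x)) a.
  by rewrite -iterD subnK // iter_n_cycle.
by rewrite -trajectD subnK.
Qed.

(** If x < y had the same itinerary, then s^t x < s^t y for every t, which is
    absurd at the time t when s^t x is the largest point. *)
Lemma itinerary_inj n c (s : 'S_n.+1) :
    s \in n_cycles n.+1 -> s \in block_increasing c n.+1 ->
  injective (fun x => itinerary c s x n.+1).
Proof.
move=> s_cyc /block_increasingP s_incr x y eq_it.
(* the itineraries of x and y agree forever, by rotating them *)
have {}eq_it t : c (iter t s x) = c (iter t s y).
  suff : itinerary c s (iter t s x) n.+1 = itinerary c s (iter t s y) n.+1.
    by case.
  elim: t => //= t /(congr1 (rot 1)).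
  by rewrite !(rot_itinerary _ _ s_cyc).
wlog lt_xy: x y eq_it / x < y.
  by move=> IH; case: (ltngtP x y) => [||/val_inj//] lt; [|apply/esym]; apply: IH.
have lt_iter t : iter t s x < iter t s y.
  by elim: t => //= t IHt; apply: s_incr.
have [t _ max_t] := iter_n_cycle_surj s_cyc x ord_max.
by have := lt_iter t; rewrite -max_t /= ltnNge -ltnS ltn_ord.
Qed.

Lemma primitive_itinerary n c (s : 'S_n.+1) x :
    s \in n_cycles n.+1 -> s \in block_increasing c n.+1 ->
  primitive (itinerary c s x n.+1).
Proof.
move=> s_cyc s_incr; apply/primitiveP=> m; rewrite size_itinerary.
case/andP=> m_gt0 lt_mn; rewrite rot_itinerary 1?ltnW //.
apply/eqP=> /(itinerary_inj s_cyc s_incr) eq_mx.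
by have := iter_n_cycle_inj s_cyc lt_mn (ltn0Sn n) eq_mx; lia.
Qed.

(** The map t |-> s^t x ranks the rotations of the itinerary of x, so that the
    itinerary determines it, and with it both x and s. *)
Lemma itinerary_pair_inj n c (s s' : 'S_n.+1) x x' :
    {homo c : i j / i <= j} ->
    s \in n_cycles n.+1 -> s \in block_increasing c n.+1 ->
    s' \in n_cycles n.+1 -> s' \in block_increasing c n.+1 ->
    itinerary c s x n.+1 = itinerary c s' x' n.+1 ->
  s = s' /\ x = x'.
Proof.
move=> c_mono s_cyc s_incr s'_cyc s'_incr eq_it.
pose w : seq nat := itinerary c s x n.+1.
pose key (t : 'I_n.+1) : seqlexi nat := rot t w.
have rankP u z : u \in n_cycles n.+1 -> u \in block_increasing c n.+1 ->
    itinerary c u z n.+1 = w ->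
    exists2 r : 'S_n.+1, forall i, r i = iter i u z
      & forall i j, r i < r j -> (key i < key j)%O.
  move=> u_cyc u_incr eq_w.
  have r_inj : injective (fun i : 'I_n.+1 => iter i u z).
    by move=> i j eq_ij; apply/val_inj/(iter_n_cycle_inj u_cyc _ _ eq_ij).
  exists (perm r_inj) => [i|i j]; rewrite !permE // => lt_ij.
  rewrite lt_neqAle /key -eq_w !rot_itinerary // 1?ltnW // le_itinerary // andbT.
  by apply: contraTneq lt_ij => /(itinerary_inj u_cyc u_incr)->; rewrite ltnn.
have [r rE r_key] := rankP s x s_cyc s_incr erefl.
have [r' r'E r'_key] := rankP s' x' s'_cyc s'_incr (esym eq_it).
have {r_key r'_key} eq_r := rank_perm_unique r_key r'_key.
have eq_iter t : t < n.+1 -> iter t s x = iter t s' x'.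
  by move=> lt_tn; rewrite -(rE (Ordinal lt_tn)) -(r'E (Ordinal lt_tn)) eq_r.
have eq_x : x = x' by exact: (eq_iter 0).
split=> //; apply/permP=> y.
have [t lt_tn ->] := iter_n_cycle_surj s_cyc x y.
rewrite {2}eq_iter // -!iterS.
case: (ltngtP t.+1 n.+1) => [/eq_iter//||[->]]; first lia.
by rewrite !iter_n_cycle.
Qed.

(** Given a primitive word, rank its rotations by r and let s carry the rank of
    each rotation to the rank of the next one: s is the conjugate by r of the
    cyclic shift of the positions. *)
Lemma itinerary_surj n c w :
    {homo c : i j / i <= j} -> perm_eq w (mkseq c n.+1) -> primitive w ->
  exists s x, [/\ s \in n_cycles n.+1, s \in block_increasing c n.+1
                & itinerary c s x n.+1 = w].
Proof.
move=> c_mono wP w_prim; have sz_w : size w = n.+1 by rewrite (perm_size wP) size_mkseq.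
pose key (i : 'I_n.+1) : seqlexi nat := rot i w.
have key_inj : injective key.
  by move=> i j eq_ij; apply/val_inj/(rot_eq_primitive w_prim _ _ eq_ij); rewrite sz_w.
have [r rE] := rank_perm_exists key_inj.
have keyE (i : 'I_n.+1) : rot i w = nth 0 w i :: (drop i.+1 w ++ take i w).
  by rewrite /rot (drop_nth 0) ?sz_w.
have keyS (i : 'I_n.+1) :
    rot (ordS i) w = rcons (drop i.+1 w ++ take i w) (nth 0 w i).
  rewrite -rot1_cons -keyE -rotS ?sz_w //=.
  have := ltn_ord i; rewrite ltnS leq_eqVlt => /predU1P[->|lt_in].
    by rewrite modnn rot0 -sz_w rot_size.
  by rewrite modn_small.
have cr := rank_perm_content c_mono wP (r := r).
have {}cr i : c (r i) = nth 0 w i.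
  apply: cr => {}i j; rewrite rE /key !keyE ltxi_cons.
  by case/andP.
pose s := ((r^-1 * perm (@ordS_inj n.+1) * r)%g : 'S_n.+1).
have sE i : s (r i) = r (ordS i) by rewrite !permM permK permE.
have iterE t (lt_tn : t < n.+1) : iter t s (r ord0) = r (Ordinal lt_tn).
  elim: t lt_tn => [|t IHt] lt_tn /=; first by congr (r _); apply: val_inj.
  rewrite (IHt (ltnW lt_tn)) sE; congr (r _); apply: val_inj => /=.
  by rewrite modn_small.
exists s, (r ord0); split.
- have s_orb : porbit s (r ord0) = setT.
    apply/setP=> y; rewrite inE -[y](permKV r).
    case: ((r^-1)%g y) => t lt_tn; rewrite -iterE.
    by apply/porbitP; exists t; rewrite permX.
  rewrite inE; apply/eqP/setP=> A; rewrite inE.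
  apply/imsetP/eqP=> [[x _ ->]|->]; last by exists (r ord0).
  by rewrite -s_orb; apply/eqP; rewrite eq_porbit_mem s_orb inE.
- apply/block_increasingP=> i j; rewrite -[i](permKV r) -[j](permKV r).
  move: ((r^-1)%g i) ((r^-1)%g j) => {}i {}j.
  rewrite !cr !sE !rE /key => lt_ij eq_c; rewrite !keyS eq_c.
  apply: ltxi_rcons.
    have size_tl (t : 'I_n.+1) : size (drop t.+1 w ++ take t w) = n.
      by have := size_rot t w; rewrite keyE sz_w => -[].
    by rewrite !size_tl.
  by move: lt_ij; rewrite !keyE eq_c eqhead_ltxiE.
apply: (@eq_from_nth _ 0); rewrite size_itinerary ?sz_w // => i lt_in.
by rewrite (nth_map (r ord0)) ?size_traject // nth_traject // iterE cr.
Qed.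

Lemma card_cycles_block_increasing n c : {homo c : i j / i <= j} ->
  #|n_cycles n.+1 :&: block_increasing c n.+1| * n.+1
    = count primitive (words c n.+1).
Proof.
move=> c_mono; rewrite -size_filter -[X in _ * X]card_ord -cardsT -cardsX.
apply: (card_eq_size (f := fun sx => itinerary c sx.1 sx.2 n.+1)).
- by rewrite filter_uniq ?permutations_uniq.
- move=> [s x] [s' x']; rewrite !in_setX.
  move=> /andP[/setIP[sC sI] _] /andP[/setIP[sC' sI'] _] /= eq_it.
  by have [-> ->] := itinerary_pair_inj c_mono sC sI sC' sI' eq_it.
- move=> [s x]; rewrite in_setX => /andP[/setIP[s_cyc s_incr] _] /=.
  rewrite mem_filter primitive_itinerary //= mem_permutations mkseq_image.
  apply: perm_map; have [u_tr tr_all] := traject_n_cycle s_cyc x.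
  by apply: uniq_perm; rewrite ?enum_uniq // => y; rewrite tr_all mem_enum.
move=> w; rewrite mem_filter mem_permutations => /andP[w_prim wP].
have [s [x [s_cyc s_incr eq_w]]] := itinerary_surj c_mono wP w_prim.
by exists (s, x); rewrite // in_setX inE s_cyc s_incr inE.
Qed.

(** * Moebius inversion on rotations *)

Lemma moebius_primeM p e :
  prime p -> 0 < e -> ~~ (p %| e) -> moebius (p * e) = (- moebius e)%R.
Proof.
move=> p_pr e_gt0 p_ndvd; have p_gt0 := prime_gt0 p_pr.
have primesE : perm_eq (primes (p * e)) (p :: primes e).
  apply: uniq_perm; rewrite /= ?primes_uniq ?andbT ?mem_primes.
  - by [].
  - by rewrite (negPf p_ndvd) !andbF.
  by move=> q; rewrite primesM // primes_prime // !inE.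
rewrite /moebius muln_gt0 p_gt0 e_gt0 /= (perm_size primesE) (perm_all _ primesE) /=.
have /eqP-> : logn p (p * e) == 1.
  by rewrite lognM // logn_prime // eqxx lognE p_pr e_gt0 (negPf p_ndvd).
have -> : all (fun q => logn q (p * e) == 1) (primes e)
          = all (fun q => logn q e == 1) (primes e).
  apply: eq_in_all => q; rewrite mem_primes => /and3P[q_pr _ q_dvd].
  rewrite lognM // logn_prime //; case: (eqVneq q p) => // eq_qp.
  by rewrite -eq_qp q_dvd in p_ndvd.
by rewrite eqxx /=; case: ifP; rewrite ?exprS ?mulN1r ?oppr0.
Qed.

Lemma moebius_square p d : prime p -> p * p %| d -> moebius d = 0%R.
Proof.
move=> p_pr dvd_d; rewrite /moebius; case: posnP => //= d_gt0.
case: ifP => // /allP/(_ p); rewrite mem_primes p_pr d_gt0.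
rewrite (dvdn_trans (dvdn_mulr p (dvdnn p)) dvd_d) => /(_ isT)/eqP log1.
by have := pfactor_dvdn 2 p_pr d_gt0; rewrite expnS expn1 dvd_d log1.
Qed.

(** For a prime p dividing q, the divisors of q with nonzero Moebius value
    cancel in pairs {e, p e}, where p does not divide e. *)
Lemma sum_moebius_divisors q : 0 < q ->
  (\sum_(d <- divisors q) moebius d = (q == 1%N)%:R :> int)%R.
Proof.
move=> q_gt0; case: (ltngtP q 1) => [|q_gt1|->]; first by case: (q) q_gt0.
  pose p := pdiv q; have p_pr : prime p := pdiv_prime q_gt1.
  have p_gt0 := prime_gt0 p_pr.
  rewrite (bigID (fun d => p %| d)) /= (bigID (fun d => p * p %| d)) /=.
  rewrite big1 ?add0r; last by move=> d /andP[_ /moebius_square->].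
  rewrite -big_filter.
  rewrite (perm_big [seq p * e | e <- [seq e <- divisors q | ~~ (p %| e)]]) /=.
    rewrite big_map big_filter -big_split big_seq_cond big1 //= => e.
    rewrite -dvdn_divisors // => /andP[e_dvd p_ndvd].
    by rewrite moebius_primeM ?(dvdn_gt0 q_gt0) // addNr.
  apply: uniq_perm.
  - by rewrite filter_uniq ?divisors_uniq.
  - rewrite map_inj_uniq ?filter_uniq ?divisors_uniq // => a b /eqP.
    by rewrite eqn_pmul2l // => /eqP.
  move=> d; rewrite mem_filter -dvdn_divisors //.
  apply/andP/mapP=> [[/andP[/dvdnP[e ->]]]|[e]].
    rewrite dvdn_pmul2r // => p_ndvd dvd_q; exists e; last by rewrite mulnC.
    by rewrite mem_filter p_ndvd -dvdn_divisors // (dvdn_trans (dvdn_mulr _ _) dvd_q).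
  rewrite mem_filter -dvdn_divisors // => /andP[p_ndvd e_dvd] ->.
  rewrite dvdn_mulr // dvdn_pmul2l // p_ndvd; split=> //.
  by rewrite Gauss_dvd ?pdiv_dvd // prime_coprime.
by rewrite big_seq1.
Qed.

(** The least positive rotation fixing w divides all the others. *)
Lemma rot_periodP (w : seq nat) : 0 < size w ->
  exists2 p, 0 < p & forall m, m <= size w -> (rot m w == w) = (p %| m).
Proof.
move=> w_gt0.
have ex_p : exists m, (0 < m) && (rot m w == w).
  by exists (size w); rewrite w_gt0 rot_size eqxx.
case: (ex_minnP ex_p) => p /andP[p_gt0 /eqP rot_p] p_min.
exists p => // m; elim/ltn_ind: m => m IH le_mn.
have [lt_mp|le_pm] := ltnP m p.
  case: (posnP m) => [->|m_gt0]; first by rewrite rot0 eqxx dvdn0.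
  rewrite gtnNdvd //; apply: contraTF lt_mp => rot_m.
  by rewrite -leqNgt p_min ?m_gt0.
rewrite -{1}(subnK le_pm) rotD ?subnK // rot_p.
rewrite IH ?ltn_subrL ?p_gt0 ?(leq_trans p_gt0) //.
  by rewrite dvdn_subl.
by rewrite (leq_trans (leq_subr _ _)).
Qed.

(** With p the period of w, the rotation by n / d fixes w exactly when d divides
    n / p; the sum of the Moebius function over the divisors of n / p vanishes
    unless p = n. *)
Lemma primitive_sum_moebius w : 0 < size w ->
  ((primitive w)%:R = \sum_(d <- divisors (size w))
     moebius d * (rot (size w %/ d)%N w == w)%:R :> int)%R.
Proof.
set n := size w => n_gt0; have [p p_gt0 rotE] := rot_periodP n_gt0.
have p_dvd : p %| n by rewrite -rotE ?rot_size.
have q_gt0 : 0 < n %/ p by rewrite divn_gt0 // dvdn_leq.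
have -> : primitive w = (n %/ p == 1).
  rewrite eq_sym eqn_div // mul1n.
  apply/primitiveP/eqP=> [w_prim|eq_np m /andP[m_gt0 lt_mn]]; last first.
    by rewrite rotE ?(ltnW lt_mn) // (gtnNdvd m_gt0) // eq_np.
  have := dvdn_leq n_gt0 p_dvd; rewrite leq_eqVlt => /predU1P[//|lt_pn].
  by have := w_prim p; rewrite p_gt0 lt_pn rotE ?dvdnn ?(ltnW lt_pn) // => /(_ isT).
rewrite -sum_moebius_divisors // (perm_big [seq d <- divisors n | p %| n %/ d]) /=.
  rewrite big_filter [LHS]big_mkcond; apply: eq_big_seq => d.
  rewrite -dvdn_divisors // => d_dvd; rewrite rotE ?leq_div //.
  by case: ifP; rewrite ?mulr1 ?mulr0.
apply: uniq_perm; rewrite ?filter_uniq ?divisors_uniq // => d.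
rewrite mem_filter -!dvdn_divisors // dvdn_divRL //.
apply/idP/andP=> [dp_dvd|[pd_dvd d_dvd]]; last by rewrite mulnC -dvdn_divRL.
have d_dvd : d %| n by rewrite (dvdn_trans (dvdn_mulr p (dvdnn d))).
by rewrite dvdn_divRL // mulnC.
Qed.

(** * Words fixed by a rotation *)

Definition seq_power (T : Type) d (u : seq T) := flatten (nseq d u).

Lemma size_seq_power T d (u : seq T) : size (seq_power d u) = d * size u.
Proof. by rewrite size_flatten /shape map_nseq sumn_nseq mulnC. Qed.

Lemma count_seq_power T d (u : seq T) a :
  count a (seq_power d u) = d * count a u.
Proof. by rewrite count_flatten map_nseq sumn_nseq mulnC. Qed.

(** A word commuting with u, of length a multiple of that of u, is a power of u:
    its prefix of the length of u is u, and the remainder still commutes. *)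
Lemma seq_power_comm (T : eqType) d (u v : seq T) :
  size v = d * size u -> v ++ u = u ++ v <-> v = seq_power d u.
Proof.
elim: d v => [|d IH] v sz_v; first by case: v sz_v; rewrite /seq_power //= cats0.
have [v' eq_v sz_v'] : exists2 v', v = take (size u) v ++ v' & size v' = d * size u.
  by exists (drop (size u) v); rewrite ?cat_take_drop // size_drop sz_v mulSn addKn.
rewrite /seq_power /= -/(seq_power d u); split=> [comm|->].
  have eq_u : take (size u) v = u.
    have := congr1 (take (size u)) comm.
    rewrite take_cat (take_size_cat v (erefl _)) sz_v mulSn.
    case: ltnP => // le_u; rewrite (_ : size u - _ = 0) ?take0 ?cats0.
      by move=> vE; rewrite vE take_size.
    by apply/eqP; rewrite subn_eq0 leq_addr.
  rewrite eq_u in eq_v; rewrite eq_v; congr (_ ++ _); apply/IH => //.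
  move: comm; rewrite eq_v -catA => /eqP; rewrite eqseq_cat // eqxx /= => /eqP.
  by [].
rewrite -catA; congr (u ++ _); apply/IH=> //.
by rewrite size_seq_power.
Qed.

Lemma rot_seq_power d (u : seq nat) : 0 < d ->
  rot (size u) (seq_power d u) = seq_power d u.
Proof.
case: d => // d _; rewrite /seq_power /= rot_size_cat.
by apply/(seq_power_comm (d := d)) => //; rewrite size_seq_power.
Qed.

Lemma rot_fixed_seq_power d m (w : seq nat) : 0 < d -> size w = d * m ->
  rot m w = w -> w = seq_power d (take m w).
Proof.
case: d => // d _ sz_w; rewrite /rot -{3}(cat_take_drop m w) => comm.
have sz_t : size (take m w) = m.
  by rewrite size_take sz_w mulSn; case: ltnP => //; lia.
have sz_d : size (drop m w) = d * size (take m w).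
  by rewrite size_drop sz_t sz_w mulSn addKn.
have /(seq_power_comm sz_d) eq_d := comm.
by rewrite /seq_power /= -/(seq_power _ _) -eq_d cat_take_drop.
Qed.

(** * Blocks of a set of allowed descents *)

(** The label of the block of position i, with positions starting at 0: a
    1-based descent j separates the positions j.-1 and j. *)
Definition block n (J : {set 'I_n}) (i : nat) : nat := #|[set j in J | j <= i]|.

Lemma homo_block n (J : {set 'I_n}) : {homo block J : i j / i <= j}.
Proof.
move=> i j le_ij; apply/subset_leq_card/subsetP=> k; rewrite !inE.
by case/andP=> -> /leq_trans->.
Qed.

Lemma ltn_block n (J : {set 'I_n}) (j : 'I_n) i :
  j \in J -> (block J i < block J j) = (i < j).
Proof.
move=> Jj; apply/idP/idP=> [|lt_ij].
  by apply: contraTT; rewrite -!leqNgt; apply: homo_block.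
apply/proper_card/properP; split.
  by apply/subsetP=> k; rewrite !inE => /andP[-> /leq_trans->] //; apply: ltnW.
by exists j; rewrite !inE Jj ?leqnn // -ltnNge.
Qed.

Lemma block_notin n (J : {set 'I_n}) (i j : 'I_n) :
  i.+1 = j -> j \notin J -> block J i = block J j.
Proof.
move=> eq_ij J'j; apply: eq_card => k; rewrite !inE -eq_ij [in RHS]leq_eqVlt ltnS.
case: eqP => //= eq_k; rewrite (_ : k = j) ?(negPf J'j) //.
by apply: val_inj; rewrite /= eq_k.
Qed.

(** Positions i < j carry the same label when no element of J lies in ]i, j];
    s then increases at every step from i to j. *)
Lemma descent_subset_block n (J : {set 'I_n}) (s : 'S_n) :
  (descent_set s \subset J) = (s \in block_increasing (block J) n).
Proof.
apply/subsetP/block_increasingP=> [sJ i j lt_ij eq_ij|s_incr i].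
  (* the large inequality makes the induction on j start at j = i *)
  rewrite ltn_neqAle (inj_eq val_inj) (inj_eq perm_inj) neq_ltn lt_ij /=.
  move/ltnW: lt_ij eq_ij; case: j => m /=; elim: m => [|m IH] lt_mn.
    by rewrite leqn0 => /eqP i0 _; rewrite (_ : Ordinal lt_mn = i) //; apply: val_inj.
  rewrite leq_eqVlt => /predU1P[i_m _|le_im eq_im].
    by rewrite (_ : Ordinal lt_mn = i) //; apply: val_inj.
  have le1 := homo_block J (n := n) (le_im : i <= m).
  have le2 := homo_block J (n := n) (leqnSn m).
  have eq_m : block J m = block J m.+1 by lia.
  apply: (leq_trans (IH (ltnW lt_mn) le_im _)); first by lia.
  rewrite leqNgt; apply: contraT; rewrite negbK => desc.
  have /sJ/(ltn_block m) : Ordinal lt_mn \in descent_set s.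
    by rewrite inE; apply/existsP; exists (Ordinal (ltnW lt_mn)); rewrite eqxx.
  by rewrite /= eq_m ltnn ltnSn.
rewrite inE => /existsP[j /andP[/eqP eq_ji lt_s]].
apply: contraLR lt_s => J'i; rewrite -leqNgt ltnW // s_incr //.
  by rewrite -eq_ji.
exact: block_notin.
Qed.

(** * Contents divisible by d *)

Lemma scale_subproof n d (i : 'I_(n %/ d)) : i * d < n.
Proof.
case: d i => [|d] i; first by have := ltn_ord i; rewrite [X in _ < X]divn0.
by have := ltn_ord i; rewrite leq_divRL // mulSn; lia.
Qed.

(** The preimage of J by this embedding is J / d. *)
Definition scale n d (i : 'I_(n %/ d)) : 'I_n := Ordinal (scale_subproof i).

Lemma scale_inj n d : 0 < d -> injective (@scale n d).
Proof.
by move=> d_gt0 i j [] /eqP; rewrite eqn_pmul2r // => /eqP/val_inj.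
Qed.

Definition dvd_set n d : {set 'I_n} := [set i : 'I_n | d %| i].

Lemma imset_scale n d (J : {set 'I_n}) : 0 < d -> d %| n ->
  scale (d := d) @: (scale (d := d) @^-1: J) = J :&: dvd_set n d.
Proof.
move=> d_gt0 d_dvd; apply/setP=> i; rewrite !inE.
apply/imsetP/andP=> [[j]|[Ji /dvdnP[q eq_i]]].
  by rewrite inE => Jj ->; rewrite Jj dvdn_mull.
have lt_q : q < n %/ d by rewrite ltn_divRL // -eq_i.
have eq_iq : i = scale (Ordinal lt_q) by apply: val_inj.
by exists (Ordinal lt_q); rewrite // inE -eq_iq.
Qed.

Lemma block_scale n d (J : {set 'I_n}) i : 0 < d -> d %| n -> J \subset dvd_set n d ->
  block J i = block (scale (d := d) @^-1: J) (i %/ d).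
Proof.
move=> d_gt0 d_dvd /setIidPl JE.
rewrite /block -(card_imset _ (@scale_inj n d d_gt0)).
apply: eq_card => j; rewrite -[in LHS]JE -imset_scale // inE.
apply/andP/imsetP=> [[/imsetP[k Jk ->]]|[k]] /=.
  by rewrite -leq_divRL // => le_k; exists k; rewrite // inE Jk.
by rewrite !inE => /andP[Jk]; rewrite leq_divRL // => le_k ->; rewrite imset_f ?inE.
Qed.

Lemma count_mkseq_divn (f : nat -> nat) d m a : 0 < d ->
  count a (mkseq (fun i => f (i %/ d)) (m * d)) = d * count a (mkseq f m).
Proof.
move=> d_gt0; elim: m => [|m IH]; first by rewrite mul0n muln0.
rewrite /mkseq mulSn addnC iotaD map_cat count_cat -/(mkseq _ _) IH.
rewrite -[m.+1]addn1 iotaD map_cat count_cat mulnDr -/(mkseq _ _); congr (_ + _).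
have -> : [seq f (i %/ d) | i <- iota (0 + m * d) d] = nseq d (f m).
  apply: (@eq_from_nth _ 0) => [|i]; rewrite size_map size_iota ?size_nseq // => lt_id.
  rewrite (nth_map 0) ?size_iota // nth_iota // nth_nseq lt_id add0n.
  by rewrite divnMDl // divn_small // addn0.
by rewrite count_nseq /= addn0 mulnC.
Qed.

(** This recovers the elements of J from the content of the word: if every
    letter occurs a multiple of d times, then d divides all of J. *)
Lemma count_lt_block n (J : {set 'I_n}) (j : 'I_n) : j \in J ->
  count (fun x => x < block J j) (mkseq (block J) n) = j.
Proof.
move=> Jj; rewrite count_map -[RHS](count_lt_iota (ltnW (ltn_ord j))).
by apply: eq_count => i; rewrite /= ltn_block.
Qed.

(** Fixed words are d-th powers, so d divides the multiplicities of their
    letters. When d divides all of J, the labelling of J has d times the content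
    of the labelling of J / d, and u |-> u^d is the required bijection. *)
Lemma count_rot_fixed_words n d (J : {set 'I_n}) : 0 < d -> d %| n ->
  count (fun w => rot (n %/ d) w == w) (words (block J) n) =
  if J \subset dvd_set n d
  then size (words (block (scale (d := d) @^-1: J)) (n %/ d)) else 0.
Proof.
move=> d_gt0 d_dvd; set m := n %/ d; set J' := _ @^-1: J.
have eq_n : n = m * d by rewrite divnK.
have fixedP w : perm_eq w (mkseq (block J) n) -> rot m w = w ->
    exists2 u, size u = m & w = seq_power d u.
  move=> wP fix_w; have sz_w : size w = n by rewrite (perm_size wP) size_mkseq.
  exists (take m w); last by apply: rot_fixed_seq_power; rewrite // sz_w mulnC.
  by rewrite size_takel // sz_w leq_div.
case: ifPn => [J_dvd|/subsetPn[j Jj]]; last first.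
  rewrite inE => d_ndvd; apply/eqP; rewrite -leqn0 leqNgt -has_count.
  apply: contra d_ndvd => /hasP[w]; rewrite mem_permutations => wP /eqP fix_w.
  have [u _ eq_w] := fixedP _ wP fix_w.
  rewrite -[X in _ %| X](count_lt_block Jj) -(seq.permP wP) eq_w count_seq_power.
  exact: dvdn_mulr.
have powP u : size u = m ->
    perm_eq (seq_power d u) (mkseq (block J) n) = perm_eq u (mkseq (block J') m).
  move=> sz_u; apply/seq.permP/seq.permP=> eq_c a.
    apply/eqP; rewrite -(eqn_pmul2l d_gt0) -count_seq_power eq_c.
    rewrite -count_mkseq_divn // -eq_n; apply/eqP; congr count.
    by apply: eq_map => i; apply: block_scale.
  rewrite count_seq_power eq_c -count_mkseq_divn // -eq_n; congr count.
  by apply/esym/eq_map => i; apply: block_scale.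
rewrite -size_filter -(size_map (seq_power d) (words (block J') m)).
have sz_words u : u \in words (block J') m -> size u = m.
  by rewrite mem_permutations => /perm_size->; rewrite size_mkseq.
apply/perm_size/uniq_perm.
- by rewrite filter_uniq ?permutations_uniq.
- rewrite map_inj_in_uniq ?permutations_uniq // => u v /sz_words sz_u /sz_words sz_v.
  case: (d) d_gt0 => // e _ /(congr1 (take m)); rewrite /seq_power /=.
  by rewrite !take_size_cat.
move=> w; rewrite mem_filter mem_permutations.
apply/andP/mapP=> [[/eqP fix_w wP]|[u uP ->]].
  have [u sz_u eq_w] := fixedP _ wP fix_w; exists u => //.
  by rewrite mem_permutations -powP // -eq_w.
rewrite powP ?sz_words // -mem_permutations uP; split=> //.
by rewrite -{1}(sz_words u uP) rot_seq_power.
Qed.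

Local Open Scope ring_scope.

(** * Inclusion-exclusion *)

(** If D is strictly contained in I, adding or removing some x in I outside D
    pairs the terms with opposite signs. *)
Lemma sum_subset_sign (T : finType) (D I : {set T}) :
  \sum_(J : {set T} | J \subset I) (-1) ^+ #|I :\: J| * (D \subset J)%:R
    = (D == I)%:R :> int.
Proof.
have [D_I|D_I] := boolP (D \subset I); last first.
  rewrite big1 => [|J J_I]; first by case: eqP D_I => // ->; rewrite subxx.
  by rewrite (_ : D \subset J = false) ?mulr0 //; apply: contraNF D_I => /subset_trans->.
have [->|] := eqVneq D I.
  rewrite (bigD1 I) //= setDv cards0 subxx mulr1 big1 ?addr0 // => J /andP[J_I].
  by rewrite eqEsubset J_I /= => /negPf->; rewrite mulr0.
rewrite eqEsubset D_I /= => /subsetPn[x Ix D'x].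
rewrite (bigID (fun J : {set T} => x \in J)) /=.
rewrite (reindex_onto (fun K => x |: K) (fun J => J :\ x)) /=; last first.
  by move=> J /andP[_ Jx]; rewrite setD1K.
rewrite (eq_bigl (fun K : {set T} => (K \subset I) && (x \notin K))) => [|K].
  rewrite -big_split big1 //= => K /andP[K_I K'x].
  have -> : (D \subset x |: K) = (D \subset K).
    apply/idP/idP=> [/subsetP sub|/subset_trans]; last by apply; apply: subsetUr.
    apply/subsetP=> y Dy; have /setU1P[eq_y|//] := sub y Dy.
    by rewrite eq_y (negPf D'x) in Dy.
  rewrite (cardsD1 x (I :\: K)) !inE K'x Ix.
  have -> : (I :\: K) :\ x = I :\: (x |: K) by rewrite setDDl setUC.
  by rewrite exprS mulN1r mulNr addrN.
rewrite subUset sub1set Ix setU11 andbT /=; congr (_ && _).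
apply/eqP/idP=> [<-|K'x]; first by rewrite !inE eqxx.
by rewrite setU1K.
Qed.

Lemma card_descent_eq n (S : {set 'S_n}) (I : {set 'I_n}) :
  #|[set s in S | descent_set s == I]|%:R =
  \sum_(J : {set 'I_n} | J \subset I)
    (-1) ^+ #|I :\: J| * #|[set s in S | descent_set s \subset J]|%:R :> int.
Proof.
have cardE (P : pred 'S_n) : #|[set s in S | P s]|%:R = \sum_(s in S) (P s)%:R :> int.
  rewrite -sum1_card natr_sum (eq_bigl (fun s => (s \in S) && P s)) => [|s].
    by rewrite big_mkcondr; apply: eq_bigr => s _; case: (P s).
  by rewrite !inE.
rewrite cardE; under [RHS]eq_bigr => J _ do rewrite cardE mulr_sumr.
by rewrite exchange_big; apply: eq_bigr => s _; rewrite sum_subset_sign.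
Qed.

(** The factor n is the number of starting points of the itineraries. *)
Lemma card_cycles_descent_subset n (J : {set 'I_n}) : (0 < n)%N ->
  n%:R * #|[set s in n_cycles n | descent_set s \subset J]|%:R =
  \sum_(d <- divisors n) moebius d *
    (if J \subset dvd_set n d
     then #|[set s : 'S_(n %/ d) | descent_set s \subset scale (d := d) @^-1: J]|
     else 0%N)%:R :> int.
Proof.
case: n J => // n J _.
have -> : [set s in n_cycles n.+1 | descent_set s \subset J] =
          n_cycles n.+1 :&: block_increasing (block J) n.+1.
  by apply/setP=> s; rewrite in_setI -descent_subset_block inE.
rewrite -natrM mulnC card_cycles_block_increasing; last exact: homo_block.
rewrite -sum1_count natr_sum big_mkcond /=.
transitivity (\sum_(w <- words (block J) n.+1) \sum_(d <- divisors n.+1)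
    moebius d * (rot (n.+1 %/ d) w == w)%:R).
  apply: eq_big_seq => w; rewrite mem_permutations => /perm_size.
  rewrite size_mkseq => sz_w; rewrite -sz_w -primitive_sum_moebius ?sz_w //.
  by case: (primitive w).
rewrite exchange_big; apply: eq_big_seq => d.
rewrite -dvdn_divisors // => d_dvd; have d_gt0 := dvdn_gt0 (ltn0Sn n) d_dvd.
rewrite -mulr_sumr; congr (_ * _).
have -> : [set s : 'S_(n.+1 %/ d) | descent_set s \subset scale (d := d) @^-1: J]
   = block_increasing (block (scale (d := d) @^-1: J)) (n.+1 %/ d).
  by apply/setP=> s; rewrite -descent_subset_block inE.
rewrite card_block_increasing; last exact: homo_block.
rewrite -count_rot_fixed_words // -sum1_count natr_sum [RHS]big_mkcond.
by apply: eq_bigr => w _; case: eqP.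
Qed.

(** For fixed d, only the J made of multiples of d contribute, i.e. the
    J = d K with K a subset of I / d. As I minus d K is the disjoint union of the
    part of I not divisible by d and of d (I / d minus K), a sign independent of
    K factors out, and inclusion-exclusion for size n / d sums the rest. *)
Lemma beta_cyc_moebius n (I : {set 'I_n}) : (0 < n)%N ->
  n%:R * (beta_cyc I)%:R =
  \sum_(d <- divisors n) moebius d *
    (-1) ^+ #|I :\: dvd_set n d| * (beta (scale (d := d) @^-1: I))%:R :> int.
Proof.
move=> n_gt0; rewrite /beta_cyc card_descent_eq mulr_sumr.
under eq_bigr => J _ do rewrite mulrCA card_cycles_descent_subset // mulr_sumr.
rewrite exchange_big; apply: eq_big_seq => d.
rewrite -dvdn_divisors // => d_dvd; have d_gt0 := dvdn_gt0 n_gt0 d_dvd.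
set I' := _ @^-1: I.
have -> : beta I' = #|[set s in setT | descent_set s == I']|.
  by apply: eq_card => s; rewrite !inE.
rewrite card_descent_eq -mulrA !mulr_sumr.
rewrite (bigID (fun J : {set 'I_n} => J \subset dvd_set n d)) /=.
rewrite [X in _ + X]big1 ?addr0; last first.
  by move=> J /andP[_ /negPf->]; rewrite !mulr0.
rewrite (reindex_onto (fun K : {set 'I_(n %/ d)} => scale (d := d) @: K)
                      (fun J => scale (d := d) @^-1: J)) /=.
  have scaleK (K : {set 'I_(n %/ d)}) : scale (d := d) @^-1: (scale (d := d) @: K) = K.
    by apply/setP=> i; rewrite inE mem_imset //; apply: scale_inj.
  rewrite (eq_bigl (fun K : {set 'I_(n %/ d)} => K \subset I')) => [|K].
    apply: eq_bigr => K K_I.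
    have K_dvd : scale (d := d) @: K \subset dvd_set n d.
      by apply/subsetP=> _ /imsetP[i _ ->]; rewrite inE dvdn_mull.
    rewrite K_dvd scaleK mulrCA; congr (_ * _).
    have -> : #|[set s in setT | descent_set s \subset K]|
            = #|[set s : 'S_(n %/ d) | descent_set s \subset K]|.
      by apply: eq_card => s; rewrite !inE.
    rewrite mulrA -exprD; congr (_ ^+ _ * _).
    rewrite -[RHS]addnC -(card_imset _ (@scale_inj n d d_gt0)).
    rewrite -(cardsID (dvd_set n d)); congr (_ + _)%N; apply: eq_card => i; last first.
      rewrite !inE; case: (boolP (d %| i)%N) => //= d_ndvd.
      by case: imsetP => // -[j _ eq_i]; rewrite eq_i dvdn_mull in d_ndvd.
    rewrite setIDAC -imset_scale // !inE.
    apply/andP/imsetP=> [[K'i /imsetP[j]]|[j]].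
      move=> I'j eq_i; exists j; rewrite // inE I'j andbT.
      by apply: contra K'i => Kj; rewrite eq_i imset_f.
    rewrite inE => /andP[K'j I'j] ->; rewrite mem_imset ?K'j ?imset_f //.
    exact: scale_inj.
  rewrite scaleK eqxx andbT.
  apply/andP/subsetP=> [[/subsetP K_I _] i Ki|K_I].
    by rewrite inE K_I ?imset_f.
  split; apply/subsetP=> _ /imsetP[i Ki ->]; rewrite ?inE ?dvdn_mull //.
  by have := K_I i Ki; rewrite inE.
by move=> J /andP[_ /setIidPl J_dvd]; rewrite imset_scale // J_dvd.
Qed.

(** * Multiples of k *)

Lemma dvdn_mul_gcdn k d i : (0 < d)%N ->
  (k %| i * d)%N = (k %/ gcdn k d %| i)%N.
Proof.
move=> d_gt0; have g_gt0 : (0 < gcdn k d)%N by rewrite gcdn_gt0 d_gt0 orbT.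
rewrite -[X in (X %| _)%N](divnK (dvdn_gcdl k d)).
rewrite -[X in (_ %| i * X)%N](divnK (dvdn_gcdr k d)) mulnA.
rewrite dvdn_pmul2r // Gauss_dvdl // /coprime.
by rewrite -(eqn_pmul2r g_gt0) muln_gcdl !divnK ?dvdn_gcdl ?dvdn_gcdr ?mul1n.
Qed.

Lemma scale_multiples n d k : (0 < d)%N ->
  scale (d := d) @^-1: (multiples k n) = multiples (k %/ gcdn k d) (n %/ d).
Proof.
move=> d_gt0; apply/setP=> i.
by rewrite !inE /= muln_gt0 d_gt0 andbT dvdn_mul_gcdn.
Qed.

Lemma card_multiples k n : (0 < k)%N -> #|multiples k n| = (n.-1 %/ k)%N.
Proof.
move=> k_gt0; rewrite cardsE cardE size_filter -enumT.
rewrite -(count_map val (fun i => (0 < i) && (k %| i))%N) val_enum_ord.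
case: n => [|n]; first by rewrite div0n.
rewrite succnK; elim: n => [|n IH]; first by rewrite div0n.
by rewrite divnS // -[n.+2]addn1 iotaD count_cat IH /= addn0 addnC.
Qed.

Theorem theorem4p7 (n k : nat) (hn : (1 <= n)%N) (hk : (1 <= k)%N) :
  (beta_cyc (multiples k n))%:R =
    n%:R^-1 *
    \sum_(d <- divisors n)
      (moebius d)%:~R
      * (-1) ^ ((n.-1 %/ k)%N%:Z - ((n - d) %/ lcmn k d)%N%:Z)
      * (gen_euler (k %/ gcdn k d) (n %/ d))%:R :> rat.
Proof.
have n_neq0 : n%:R != 0 :> rat by rewrite pnatr_eq0 -lt0n.
apply: (mulfI n_neq0); rewrite mulVKf //.
have := congr1 (intr : int -> rat) (beta_cyc_moebius (multiples k n) hn).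
rewrite rmorphM !rmorph_nat => ->; rewrite rmorph_sum.
apply: eq_big_seq => d; rewrite -dvdn_divisors // => d_dvd.
have d_gt0 := dvdn_gt0 hn d_dvd.
rewrite !rmorphM rmorph_nat rmorphXn rmorphN1 scale_multiples //=.
congr (_ * _ * _).
have g_gt0 : (0 < gcdn k d)%N by rewrite gcdn_gt0 hk.
have k'_gt0 : (0 < k %/ gcdn k d)%N by rewrite divn_gt0 // dvdn_leq // dvdn_gcdl.
(* the two quotients of the exponent count the multiples of k below n and
   those that are also multiples of d *)
have -> : ((n - d) %/ lcmn k d)%N = #|multiples k n :&: dvd_set n d|.
  rewrite -imset_scale // card_imset; last exact: scale_inj.
  rewrite scale_multiples // card_multiples //.
  have -> : lcmn k d = (k %/ gcdn k d * d)%N by rewrite divn_mulAC ?dvdn_gcdl.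
  have -> : (n - d = (n %/ d).-1 * d)%N by rewrite -subn1 mulnBl mul1n divnK.
  by rewrite divnMr.
rewrite -card_multiples // -(cardsID (dvd_set n d) (multiples k n)) PoszD.
by rewrite addrAC subrr add0r exprnP.
Qed.
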